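(* Let $\mathcal{A}$ be a set of $m$ agents and $\mathcal{B}$ a set of $n$ tasks, $\mathcal{A}\cap\mathcal{B}=\emptyset$, $m\ge n\ge1$, and let $\mathcal{G}_b=(\mathcal{V}_b,\mathcal{E}_b)$ be the complete bipartite graph with $\mathcal{V}_b=\mathcal{A}\cup\mathcal{B}$, with edge weights, in the distributed setting described in the context. Let $\mathcal{E}'\subseteq\mathcal{E}_b$, let $\mathcal{M}\subseteq\mathcal{E}'$ be a maximum cardinality matching (MCM) of $\mathcal{G}_b$, let $\bar e=\{\bar i,\bar j\}\in\mathcal{M}$ with $\bar i\in\mathcal{A}$, $\bar j\in\mathcal{B}$, and put $\bar{\mathcal{M}}=\mathcal{M}\setminus\{\bar e\}$ and $\bar{\mathcal{E}}=\mathcal{E}'\setminus\{\bar e\}$. Then $\mathrm{AugDFS}(\bar e,\bar{\mathcal{M}},(\mathcal{V}_b,\bar{\mathcal{E}}))$, as defined in the context, determines whether there is an augmenting path relative to $\bar{\mathcal{M}}$ contained in $\bar{\mathcal{E}}$: if such a path exists, it returns an MCM $\mathcal{M}_\nu=\bar{\mathcal{M}}\oplus\mathcal{P}$ of $\mathcal G_b$ for some augmenting path $\mathcal{P}\subseteq\bar{\mathcal{E}}$ relative to $\bar{\mathcal{M}}$; if no such path exists, it returns $\mathcal{M}_\nu=\bar{\mathcal{M}}$.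
   Context: $\oplus$ is symmetric difference. A *path* is the edge set $\{\{v_k,v_{k+1}\}\mid1\le k\le l\}$ of a sequence of distinct vertices with consecutive vertices adjacent. It is *alternating* relative to a matching $\mathcal{M}$ if each vertex incident to an edge of it is incident to at most one of its edges in $\mathcal{M}$ and at most one of its edges not in $\mathcal{M}$. A vertex is *free* if no edge of the matching is incident to it. An *augmenting path* is an alternating path whose two (distinct) end vertices are free. **Distributed setting.** Each agent $i$ has access to its incident edges $\{i,j\}$, $j\in\mathcal{B}$, and their weights. Agents share a global clock and at each time step exchange local information (or relay information received earlier) with their neighbours in a time-invariant, undirected, connected communication graph on $\mathcal{A}$. Matchings are stored jointly: agent $i$ stores its matched task $m_i$, with $m_i=-1$ if $i$ is free ($-1$ is a symbol not in $\mathcal{A}\cup\mathcal{B}$). **AugDFS** (a distributed depth-first search). $F\leftarrow\emptyset$ (explored agents); $m_i$ is the task matched to $i$ in $\bar{\mathcal{M}}$ (or $-1$); $\nu_i\leftarrow m_i$ for all $i\in\mathcal{A}$; $t\leftarrow\bar j$. Repeat until the search is complete: let $S_t=\{i\in\mathcal{A}\mid i\notin F,\{i,t\}\in\bar{\mathcal{E}}\}$ and, if $S_t\neq\emptyset$, choose some $a^*\in S_t$ (arbitrarily). - If $S_t=\emptyset$ and $t=\bar j$: the search is complete. - If $S_t=\emptyset$ and $t\ne\bar j$: let $a^*$ be the agent with $m_{a^*}=t$; set $t\leftarrow\nu_{a^*}$, then $\nu_{a^*}\leftarrow m_{a^*}$. - If $S_t\ne\emptyset$ and $m_{a^*}=-1$: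 set $\nu_{a^*}\leftarrow t$; the search is complete. - Otherwise: $\nu_{a^*}\leftarrow t$, $F\leftarrow F\cup\{a^*\}$, $t\leftarrow m_{a^*}$. Return $\mathcal{M}_\nu=\{\{i,\nu_i\}\mid i\in\mathcal{A},\nu_i\neq-1\}$. In the distributed implementation each agent stores $\nu_i$ and a last-in-first-out stack of tasks recording the current $t$; the agents agree on $a^*$ by consensus, and the explored agent $a^*$ communicates $m_{a^*}$ to all agents. *)

(* Defs.v *)
From mathcomp Require Import all_boot.

Set Implicit Arguments.
Unset Strict Implicit.
Unset Printing Implicit Defensive.

(* A graph on the finite vertex type V is given by its edge set
   E : {set {set V}}, an edge {u, v} being the set [set u; v]. *)
Section Graphs.
Variable V : finType.
Implicit Types (E M P : {set {set V}}) (u v x y : V) (p : seq V).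

Definition adjacent E : rel V := fun u v => [set u; v] \in E.

Definition symdiff E1 E2 : {set {set V}} := (E1 :\: E2) :|: (E2 :\: E1).

(* trivIset: distinct edges of M have no common end. *)
Definition matching E M : Prop := M \subset E /\ trivIset M.

Definition max_card_matching E M : Prop :=
  matching E M /\ forall M', matching E M' -> #|M'| <= #|M|.

Definition free M v : Prop := forall e, e \in M -> v \notin e.

(* The edges {v_k, v_(k+1)} of the vertex sequence x :: p. *)
Definition seq_edges x p : {set {set V}} :=
  [set:: pairmap (fun u v => [set u; v]) x p].

Definition path_between E x y P : Prop :=
  exists p, [/\ path (adjacent E) x p, uniq (x :: p), last x p = y
              & P = seq_edges x p].

Definition alternating M P : Prop :=
  forall v, (exists2 e, e \in P & v \in e) ->
    #|[set e in P | (v \in e) && (e \in M)]| <= 1 /\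
    #|[set e in P | (v \in e) && (e \notin M)]| <= 1.

Definition augmenting_path E M P : Prop :=
  exists x y, [/\ path_between E x y P, alternating M P, x != y,
                  free M x & free M y].

End Graphs.

Section AugDFS.
Variables A B : finType.

(* The sum type A + B makes agents and tasks disjoint. *)
Definition edge (i : A) (j : B) : {set A + B} := [set inl i; inr j].

Definition complete_bipartite : {set {set A + B}} :=
  [set edge i j | i : A, j : B].

(* m_i; the symbol -1 is None. *)
Definition matched_task (M : {set {set A + B}}) (i : A) : option B :=
  [pick j | edge i j \in M].

Record state := State {
  explored : {set A};
  nu : {ffun A -> option B};
  cur : B;
  complete : bool
}.

(* Only the task end jb of the removed edge is used by the search. *)
Variables (jb : B) (M E : {set {set A + B}}).

Definition init : state :=
  State set0 [ffun i => matched_task M i] jb false.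

Definition candidates (F : {set A}) (t : B) : {set A} :=
  [set i | (i \notin F) && (edge i t \in E)].

Definition upd (f : {ffun A -> option B}) (a : A) (o : option B) :
  {ffun A -> option B} := [ffun i => if i == a then o else f i].

(* One iteration of the loop; the arbitrary choice of a makes it a relation.
   The premise of step_back on f a only names the task stored in nu_a (the
   current task has to be a task); that the search cannot get stuck because
   of it is part of augdfs_terminates. *)
Inductive step : state -> state -> Prop :=
| step_fail F (f : {ffun A -> option B}) t :
    candidates F t = set0 -> t = jb ->
    step (State F f t false) (State F f t true)
| step_back F (f : {ffun A -> option B}) t a t' :
    candidates F t = set0 -> t != jb ->
    matched_task M a = Some t -> f a = Some t' ->
    step (State F f t false) (State F (upd f a (matched_task M a)) t' false)
| step_found F (f : {ffun A -> option B}) t a :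
    a \in candidates F t -> matched_task M a = None ->
    step (State F f t false) (State F (upd f a (Some t)) t true)
| step_explore F (f : {ffun A -> option B}) t a t' :
    a \in candidates F t -> matched_task M a = Some t' ->
    step (State F f t false) (State (a |: F) (upd f a (Some t)) t' false).

Inductive reachable : state -> Prop :=
| reachable_init : reachable init
| reachable_step s s' : reachable s -> step s s' -> reachable s'.

Definition augdfs_terminates : Prop :=
  (~ exists r : nat -> state, r 0 = init /\ forall k, step (r k) (r k.+1)) /\
  (forall s, reachable s -> ~~ complete s -> exists s', step s s').

Definition matching_of (f : {ffun A -> option B}) : {set {set A + B}} :=
  [set e | [exists i, exists j, (f i == Some j) && (e == edge i j)]].

Definition augdfs_returns (Mnu : {set {set A + B}}) : Prop :=
  exists s, [/\ reachable s, complete s & Mnu = matching_of (nu s)].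

End AugDFS.

(* Main.v *)
(* The loop maintains a branch: the agents a_k, ..., a_1 explored and not yet
   backtracked, where t_0 = jb, a_i is matched to t_i and nu sends a_i to
   t_(i-1); elsewhere nu is the matching.  A free agent adjacent to the current
   task t_k closes the branch into an augmenting path from this agent to jb, and
   nu is then the matching flipped along it.  If instead jb is abandoned, every
   neighbour of jb, or of the task of an explored agent, is explored and hence
   matched.  A maximum matching saturates the tasks (there are at least as many
   agents), so jb is the only free task; an alternating walk from jb never
   leaves the explored part, one from a free agent never enters it, and neither
   can end at a free vertex. *)
Require Import Defs.
From mathcomp Require Import all_boot all_order all_algebra.

Set Implicit Arguments.
Unset Strict Implicit.
Unset Printing Implicit Defensive.

(** * Alternating walks in an arbitrary graph *)

(** An alternating set has at most one edge inside [M] and at most one outside at [v], so two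
    distinct edges at [v] cannot lie on the same side. *)
Lemma alternating_switch (V : finType) (M P : {set {set V}}) (u v w : V) :
  alternating M P -> [set u; v] \in P -> [set v; w] \in P -> u != w ->
  u != v -> ([set v; w] \in M) = ([set u; v] \notin M).
Proof.
move=> altP uvP vwP neq_uw neq_uv.
have v_uv : v \in [set u; v] by rewrite !inE eqxx orbT.
have v_vw : v \in [set v; w] by rewrite !inE eqxx.
have neq_e : [set u; v] <> [set v; w].
  by move/setP/(_ u); rewrite !inE eqxx (negPf neq_uv) (negPf neq_uw).
have [] := altP v; first by exists [set u; v].
move=> /card_le1_eqP in1 /card_le1_eqP out1.
case: (boolP ([set u; v] \in M)) => uvM;
case: (boolP ([set v; w] \in M)) => vwM //.
- by case: neq_e; apply: in1; rewrite inE ?uvP ?vwP ?uvM ?vwM ?v_uv ?v_vw.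
- by case: neq_e; apply: out1; rewrite inE ?uvP ?vwP ?uvM ?vwM ?v_uv ?v_vw.
Qed.

(** The first edge leaves a free vertex, so it lies outside [M]; from then on the walk alternates
    between [X] and [Y]. It can stop only in [Y], which has no free vertex, or in [X] right after an
    edge of [M]. *)
Lemma alternating_walk_trapped (V : finType) (E M P : {set {set V}})
    (X Y : {set V}) (x : V) (p : seq V) :
  (forall u v : V, u \in X -> [set u; v] \in E -> [set u; v] \notin M ->
    v \in Y) ->
  (forall u v : V, u \in Y -> [set u; v] \in M -> v \in X) ->
  (forall v, v \in Y -> ~ Defs.free M v) ->
  alternating M P -> P \subset E -> {subset seq_edges x p <= P} ->
  uniq (x :: p) -> x != last x p -> x \in X -> Defs.free M x ->
  ~ Defs.free M (last x p).
Proof.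
move=> XY YX Ymatched altP /subsetP PE edgesP Uxp x_last xX freex.
have freeNM (v u : V) (e : {set V}) : Defs.free M v -> e = [set v; u] -> e \notin M.
  by move=> freev ->; apply/negP => /freev; rewrite !inE eqxx.
have : if p is v :: _ then [set x; v] \notin M else true.
  by case: p {edgesP Uxp x_last} => // v p; apply: freeNM freex _.
case: p edgesP Uxp x_last => [|v p]; first by rewrite eqxx.
move=> + + _ + freel; move: freel {freex}; rewrite /=.
(* Induction on a bound for the length, since each round consumes two edges, one outside [M] and one
   inside. *)
elim: {p}(size p).+1 {-2}p (ltnSn (size p)) x v xX => // k IHk p szp x v xX.
move=> freel edgesP Uxp xvM.
have inP e : e \in pairmap (fun u v => [set u; v]) x (v :: p) -> e \in P.
  by move=> ?; apply: edgesP; rewrite inE.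
have xvP : [set x; v] \in P by apply: inP; rewrite mem_head.
have vY : v \in Y by apply: XY xX (PE _ xvP) xvM.
case: p szp freel edgesP Uxp inP => [|w p] szp freel edgesP Uxp inP.
  exact: Ymatched vY freel.
have vwP : [set v; w] \in P by apply: inP; rewrite !inE eqxx orbT.
have [neq_xv neq_xw neq_vw] : [/\ x != v, x != w & v != w].
  by move: Uxp; rewrite /= !inE !negb_or -!andbA => /and5P[-> -> _ ->].
have vwM : [set v; w] \in M by rewrite (alternating_switch altP xvP vwP).
have wX : w \in X by apply: YX vY vwM.
case: p szp freel edgesP Uxp inP => [|z p] szp freel edgesP Uxp inP.
  by move/freel: vwM; rewrite !inE eqxx orbT.
have wzP : [set w; z] \in P by apply: inP; rewrite !inE eqxx !orbT.
apply: (IHk p _ w z wX) => //.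
- by rewrite -ltnS (leq_trans _ szp) //= ltnW.
- by move=> e; rewrite inE => e_in; apply: inP; rewrite 2!in_cons e_in !orbT.
- by case/and3P: Uxp.
- rewrite (alternating_switch altP vwP wzP) ?vwM //.
  by move: Uxp; rewrite /= !inE !negb_or => /and4P[_ /and3P[_ -> _]].
Qed.

(** * Matchings of the complete bipartite graph as partial maps from agents to tasks *)

Section Matchings.
Variables A B : finType.
Implicit Types (M E : {set {set A + B}}) (f : {ffun A -> option B}).

Lemma edge_inj (i i' : A) (j j' : B) : edge i j = edge i' j' -> i = i' /\ j = j'.
Proof.
move=> eq_e; split.
- have: inl i \in edge i' j' by rewrite -eq_e !inE eqxx.
  by rewrite !inE orbF => /eqP[].
- have: inr j \in edge i' j' by rewrite -eq_e !inE eqxx orbT.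
  by rewrite !inE => /eqP[].
Qed.

Lemma edge_eqE (i i' : A) (j j' : B) :
  (edge i j == edge i' j') = (i == i') && (j == j').
Proof. by apply/eqP/andP => [/edge_inj[-> ->]|[/eqP-> /eqP->]]. Qed.

Lemma in_edge_inl (a i : A) (j : B) : (inl a \in edge i j) = (a == i).
Proof. by rewrite !inE orbF. Qed.

Lemma in_edge_inr (t : B) (i : A) (j : B) : (inr t \in edge i j) = (t == j).
Proof. by rewrite !inE. Qed.

Lemma bipartite_edgeP M e : M \subset complete_bipartite A B -> e \in M ->
  exists i j, e = edge i j.
Proof. by move=> /subsetP/[apply] /imset2P[i j _ _ ->]; exists i, j. Qed.

Lemma bipartite_inl M a v : M \subset complete_bipartite A B ->
  [set inl a; v] \in M -> exists2 j, v = inr j & edge a j \in M.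
Proof.
move=> bipM avM; have [i [j e_av]] := bipartite_edgeP bipM avM.
have := in_edge_inl a i j; rewrite -e_av !inE eqxx => /esym/eqP eq_ai.
have := in_edge_inr j i j; rewrite -e_av !inE eqxx /= => /eqP eq_vj.
by exists j; rewrite // eq_ai -e_av.
Qed.

Lemma bipartite_inr M t v : M \subset complete_bipartite A B ->
  [set inr t; v] \in M -> exists2 i, v = inl i & edge i t \in M.
Proof.
move=> bipM tvM; have [i [j e_tv]] := bipartite_edgeP bipM tvM.
have := in_edge_inr t i j; rewrite -e_tv !inE eqxx => /esym/eqP eq_tj.
have := in_edge_inl i i j; rewrite -e_tv !inE eqxx /= => /eqP eq_vi.
by exists i; rewrite // eq_tj -e_tv.
Qed.

Definition injective_matched (f : A -> option B) : Prop :=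
  forall i i' j, f i = Some j -> f i' = Some j -> i = i'.

Lemma mem_matching_of f i j : (edge i j \in matching_of f) = (f i == Some j).
Proof.
rewrite inE; apply/existsP/idP => [[i' /existsP[j' /andP[fi' /eqP]]]|fij].
  by move=> /edge_inj[-> ->].
by exists i; apply/existsP; exists j; rewrite fij eqxx.
Qed.

Lemma matching_of_bipartite f : matching_of f \subset complete_bipartite A B.
Proof.
apply/subsetP => e; rewrite inE => /existsP[i /existsP[j /andP[_ /eqP->]]].
exact: imset2_f.
Qed.

Lemma bipartite_eqP M M' :
  M \subset complete_bipartite A B -> M' \subset complete_bipartite A B ->
  (forall i j, (edge i j \in M) = (edge i j \in M')) -> M = M'.
Proof.
move=> bipM bipM' eqMM'; apply/setP => e; apply/idP/idP => eM.
- by have [i [j e_ij]] := bipartite_edgeP bipM eM; rewrite e_ij -eqMM' -e_ij.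
- by have [i [j e_ij]] := bipartite_edgeP bipM' eM; rewrite e_ij eqMM' -e_ij.
Qed.

(** Edges sharing an agent coincide because [f] is a function, edges sharing a task because [f] is
    injective on matched agents. *)
Lemma matching_of_matching f : injective_matched f ->
  matching (complete_bipartite A B) (matching_of f).
Proof.
move=> f_inj; split; first exact: matching_of_bipartite.
apply/trivIsetP => e e'.
move=> /[dup] /(bipartite_edgeP (matching_of_bipartite f))[i [j ->]].
rewrite mem_matching_of => /eqP fi.
move=> /[dup] /(bipartite_edgeP (matching_of_bipartite f))[i' [j' ->]].
rewrite mem_matching_of => /eqP fi' neq_e; apply: contraR neq_e.
move=> /pred0Pn[[a|t] /andP[/=]].
- rewrite !in_edge_inl => /eqP-> /eqP eq_i.
  by move: fi'; rewrite -eq_i fi => -[->].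
- rewrite !in_edge_inr => /eqP-> /eqP eq_j.
  by move: fi'; rewrite -eq_j => /(f_inj _ _ _ fi)->.
Qed.

Lemma card_matching_of f : #|matching_of f| = #|[set i | f i]|.
Proof.
(* The value [set0] is a dummy: [g] is only applied to agents with a task. *)
pose g i : {set A + B} := if f i is Some j then edge i j else set0.
suff -> : matching_of f = g @: [set i | f i].
  apply: card_in_imset => i i'; rewrite !inE /g.
  by case: (f i) => // j _; case: (f i') => // j' _ /edge_inj[].
apply/setP => e; apply/idP/imsetP.
  move=> /[dup] /(bipartite_edgeP (matching_of_bipartite f))[i [j ->]].
  by rewrite mem_matching_of => /eqP fi; exists i; rewrite ?inE /g fi.
move=> [i]; rewrite inE /g; case fi: (f i) => [j|] // _ ->.
by rewrite mem_matching_of fi.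
Qed.

Section MatchedTask.
Variable M : {set {set A + B}}.
Hypothesis matchingM : matching (complete_bipartite A B) M.

Lemma matching_sharing (e e' : {set A + B}) v :
  e \in M -> e' \in M -> v \in e -> v \in e' -> e = e'.
Proof.
have [_ /trivIsetP trivM] := matchingM.
move=> eM e'M ve ve'; apply/eqP; apply/idPn => /(trivM _ _ eM e'M).
by move/pred0P/(_ v); rewrite /= ve ve'.
Qed.

(** [pick] returns some task; it is the only one because edges of a matching that share [i]
    coincide. *)
Lemma matched_taskP i j : reflect (matched_task M i = Some j) (edge i j \in M).
Proof.
rewrite /matched_task; case: pickP => [j' ij'M|noM].
  apply: (iffP idP) => [ijM|[<-]//].
  have /edge_inj[_ ->//] : edge i j' = edge i j.
  by apply: (matching_sharing (v := inl i)); rewrite ?in_edge_inl.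
by rewrite noM; constructor.
Qed.

Lemma matched_task_inj : injective_matched (matched_task M).
Proof.
move=> i i' j /matched_taskP ijM /matched_taskP i'jM.
have /edge_inj[-> //] : edge i j = edge i' j.
by apply: (matching_sharing (v := inr j)); rewrite ?in_edge_inr.
Qed.

Lemma matching_of_matched_task : matching_of [ffun i => matched_task M i] = M.
Proof.
apply: bipartite_eqP; [exact: matching_of_bipartite | by case: matchingM |].
move=> i j; rewrite mem_matching_of ffunE.
by apply/eqP/idP => /matched_taskP.
Qed.

Lemma free_agentP a : matched_task M a = None <-> Defs.free M (inl a).
Proof.
have [bipM _] := matchingM; split=> [ma e eM|freea].
  have [i [j e_ij]] := bipartite_edgeP bipM eM; rewrite e_ij in_edge_inl.
  apply/eqP => eq_ai; move: eM; rewrite e_ij -eq_ai => /matched_taskP.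
  by rewrite ma.
case ma: (matched_task M a) => [j|//]; move/matched_taskP: ma => /freea.
by rewrite in_edge_inl eqxx.
Qed.

Lemma free_taskP t : (forall i, matched_task M i <> Some t) <-> Defs.free M (inr t).
Proof.
have [bipM _] := matchingM; split=> [mt e eM|freet i].
  have [i [j e_ij]] := bipartite_edgeP bipM eM; rewrite e_ij in_edge_inr.
  apply/eqP => eq_tj; move: eM; rewrite e_ij -eq_tj => /matched_taskP.
  exact: mt.
by move=> /matched_taskP /freet; rewrite in_edge_inr eqxx.
Qed.

End MatchedTask.

Lemma upd_same f a o : upd f a o a = o.
Proof. by rewrite ffunE eqxx. Qed.

Lemma upd_other f a o i : i != a -> upd f a o i = f i.
Proof. by rewrite ffunE => /negPf->. Qed.

Lemma card_matching_upd f a t : f a = None ->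
  #|matching_of (upd f a (Some t))| = #|matching_of f|.+1.
Proof.
move=> fa; rewrite !card_matching_of.
have -> : [set i | upd f a (Some t) i] = a |: [set i | f i].
  by apply/setP => i; rewrite !inE ffunE; case: eqP.
by rewrite cardsU1 inE fa.
Qed.

(** If [t] were unmatched, some agent would be free, since otherwise the agents would inject into
    the tasks other than [t]. Joining that agent to [t] gives a larger matching. *)
Lemma max_matching_saturates M : #|B| <= #|A| ->
  max_card_matching (complete_bipartite A B) M ->
  forall t, exists i, edge i t \in M.
Proof.
move=> leBA [matchingM maxM] t; apply/existsP; apply: contraT.
rewrite negb_exists => /forallP notM.
pose f := [ffun i => matched_task M i].
have f_inj : injective_matched f.
  by move=> i i' j; rewrite !ffunE; apply: matched_task_inj.
have ft i : f i <> Some t.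
  by rewrite ffunE => /(matched_taskP matchingM); apply/negP.
have [a fa] : exists a, f a = None.
  (* When no agent is free, the default [t] in [g] is never taken. *)
  case: (pickP (fun a => f a == None)) => [a /eqP ?|allS]; first by exists a.
  pose g i := odflt t (f i).
  have f_g i : f i = Some (g i) by rewrite /g; move: (allS i); case: (f i).
  have g_inj : injective g.
    by move=> i i' eq_g; apply: f_inj (f_g i) _; rewrite f_g eq_g.
  have : #|[set t]| + #|g @: setT| <= #|B|.
    rewrite -cardsUI (_ : _ :&: _ = set0) ?cards0 ?addn0 ?max_card //.
    apply/setP => j; rewrite !inE; apply/andP => -[/eqP-> /imsetP[i _ t_g]].
    by apply: (ft i); rewrite f_g t_g.
  by rewrite cards1 card_imset // cardsT add1n ltnNge leBA.
have := maxM (matching_of (upd f a (Some t))).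
rewrite card_matching_upd // matching_of_matched_task // ltnn => absurd.
apply: absurd; apply: matching_of_matching => i i' j.
by rewrite !(ffunE (fun i => if _ then _ else _));
  do 2![case: eqP => [->|_]] => //;
  [move=> [<-] /ft | move=> + [eq_t]; rewrite -eq_t => /ft | apply: f_inj].
Qed.

End Matchings.

Lemma unzip2_uniq_inj (A B : eqType) (s : seq (A * B)) i i' j :
  uniq (unzip2 s) -> (i, j) \in s -> (i', j) \in s -> i = i'.
Proof.
elim: s => //= -[a t] s IHs /andP[ts Us]; rewrite !inE.
have notin k : (k, t) \notin s by apply: contra ts => /(map_f snd).
case/predU1P => [[-> ->]|ij_s].
  by case/predU1P => [[]|/(negP (notin i'))].
case/predU1P => [[-> eq_j]|i'j_s]; last exact: IHs.
by move: (notin i); rewrite -eq_j ij_s.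
Qed.

(** * The branch of the search and the assignment flipped along it *)

Section Search.
Variables A B : finType.
Variables (jb : B) (M E : {set {set A + B}}).
Hypothesis matchingM : matching (complete_bipartite A B) M.
Hypothesis jb_unmatched : forall i, matched_task M i <> Some jb.
Hypothesis saturated : forall t, t != jb -> exists i, matched_task M i = Some t.
Hypothesis bipartiteE : E \subset complete_bipartite A B.
Hypothesis subME : M \subset E.

Local Notation mt := (matched_task M).
Local Notation bipartite := (complete_bipartite A B).
Implicit Types (s : seq (A * B)) (t j : B) (i a : A) (F : {set A}).
Implicit Types (f : {ffun A -> option B}) (S : state A B).

(* s lists the pairs (a, nu_a), the most recently explored agent first; t is the
   current task. *)
Fixpoint branch s t : Prop :=
  if s is (a, t') :: s' then [/\ mt a = Some t, edge a t' \in E & branch s' t']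
  else t = jb.

(** Stated for any list, so that a free agent closing a branch can be put at its head. *)
Definition flips s f : Prop :=
  (forall i j, (i, j) \in s -> f i = Some j) /\
  (forall i, i \notin unzip1 s -> f i = mt i).

Lemma branch_task s t j : branch s t -> j \in t :: unzip2 s ->
  j = jb \/ exists2 i, i \in unzip1 s & mt i = Some j.
Proof.
elim: s t => [|[a t'] s IHs] t /=; first by move->; rewrite inE => /eqP; left.
case=> mta _ /IHs{}IHs; rewrite inE => /predU1P[->|/IHs[->|[i i_s mti]]].
- by right; exists a; rewrite ?mem_head.
- by left.
- by right; exists i; rewrite // in_cons i_s orbT.
Qed.

Lemma branch_matched s t i : branch s t -> i \in unzip1 s -> mt i.
Proof.
elim: s t => [|[a t'] s IHs] t //= [mta _ br]; rewrite inE.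
by case/predU1P => [->|/(IHs _ br)//]; rewrite mta.
Qed.

Lemma branch_edge s t i j : branch s t -> (i, j) \in s -> edge i j \in E.
Proof.
elim: s t => [|[a t'] s IHs] t //= [_ at'E br]; rewrite inE.
by case/predU1P => [[-> ->]//|/(IHs _ br)].
Qed.

(** A repeated task would be [jb], although matched to an agent, or the matched task of two distinct
    branch agents. *)
Lemma branch_uniq_tasks s t :
  branch s t -> uniq (unzip1 s) -> uniq (t :: unzip2 s).
Proof.
elim: s t => [|[a t'] s IHs] t //= [mta _ br] /andP[a_s Us].
have := IHs _ br Us; rewrite /= => ->; rewrite andbT; apply/negP.
case/(branch_task br) => [eq_t|[i i_s mti]].
  by case: (jb_unmatched (i := a)); rewrite mta eq_t.
by move: a_s; rewrite (matched_task_inj matchingM mta mti) i_s.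
Qed.

(** [mt i] stands just before [j] in the list of branch tasks, which has no repetition. *)
Lemma branch_flipped s t i j :
  branch s t -> uniq (unzip1 s) -> (i, j) \in s -> mt i <> Some j.
Proof.
elim: s t => [|[a t'] s IHs] t //= br Us; rewrite inE.
have : branch ((a, t') :: s) t by []. move/branch_uniq_tasks => /(_ Us)/andP[t_s _].
case: br => mta _ br.
case/predU1P => [[-> ->]|ij_s]; last by case/andP: Us => _ /(IHs _ br); apply.
by rewrite mta => -[eq_t]; move: t_s; rewrite eq_t /= mem_head.
Qed.

Lemma flips_mem s f i : flips s f -> i \in unzip1 s ->
  exists2 j, (i, j) \in s & f i = Some j.
Proof. by move=> [f_s _] /mapP[[i' j] ij_s /= ->]; exists j => //; apply: f_s. Qed.

(** The mixed case is the essential one: a task used on the branch is [jb] or is matched to a branch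
    agent, so no agent off the branch is matched to it. *)
Lemma flips_injective a t s f : branch s t -> uniq (unzip1 ((a, t) :: s)) ->
  flips ((a, t) :: s) f -> injective_matched f.
Proof.
move=> br U1 flf; have /andP[_ Us] := U1.
have U2 : uniq (unzip2 ((a, t) :: s)) := branch_uniq_tasks br Us.
have crossed i i' j : i \in unzip1 ((a, t) :: s) ->
    i' \notin unzip1 ((a, t) :: s) ->
    f i = Some j -> f i' <> Some j.
  move=> i_s i'_s fi; rewrite (flf.2 i' i'_s) => mti'.
  have [j' ij'_s] := flips_mem flf i_s; rewrite fi => -[eq_j].
  have /(branch_task br) : j \in t :: unzip2 s.
    by rewrite eq_j; apply: (map_f snd ij'_s).
  case=> [eq_jb|[i0 i0_s mti0]].
    by case: (jb_unmatched (i := i')); rewrite -eq_jb.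
  by move: i'_s; rewrite (matched_task_inj matchingM mti' mti0) in_cons i0_s orbT.
move=> i i' j fi fi'.
have [i_s|i_s] := boolP (i \in unzip1 ((a, t) :: s));
have [i'_s|i'_s] := boolP (i' \in unzip1 ((a, t) :: s)).
- have [j1 ij1_s] := flips_mem flf i_s; rewrite fi => -[eq_j1].
  have [j2 ij2_s] := flips_mem flf i'_s; rewrite fi' => -[eq_j2].
  rewrite -eq_j1 in ij1_s; rewrite -eq_j2 in ij2_s.
  exact: unzip2_uniq_inj U2 ij1_s ij2_s.
- by case: (crossed i i' j).
- by case: (crossed i' i j).
- by move: fi fi'; rewrite !flf.2 //; apply: matched_task_inj.
Qed.

(** * The augmenting path read off the branch *)

(** Preceded by the current task, this is the walk back to [jb], using for each agent its matching
    edge and then the edge by which it was explored. *)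
Fixpoint vertices s : seq (A + B) :=
  if s is (a, t) :: s' then inl a :: inr t :: vertices s' else [::].

Lemma inl_vertices s i : (inl i \in vertices s) = (i \in unzip1 s).
Proof. by elim: s => //= -[a t] s IHs; rewrite !inE IHs. Qed.

Lemma inr_vertices s j : (inr j \in vertices s) = (j \in unzip2 s).
Proof. by elim: s => //= -[a t] s IHs; rewrite !inE IHs. Qed.

Lemma uniq_vertices s : uniq (vertices s) = uniq (unzip1 s) && uniq (unzip2 s).
Proof.
elim: s => //= -[a t] s /= ->.
by rewrite !inE inl_vertices inr_vertices /= -!andbA; do !bool_congr.
Qed.

Lemma path_vertices s t : path (adjacent bipartite) (inr t) (vertices s).
Proof.
elim: s t => //= -[a t'] s IHs t /=; rewrite /adjacent IHs andbT.
by rewrite setUC; apply/andP; split; apply: imset2_f.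
Qed.

Lemma last_vertices s t : branch s t -> last (inr t) (vertices s) = inr jb.
Proof. by elim: s t => [t ->|[a t'] s IHs t [_ _ /IHs]]. Qed.

Lemma edges_vertices s t i j : branch s t ->
  (edge i j \in pairmap (fun u v => [set u; v]) (inr t) (vertices s)) =
  ((i, j) \in s) || (i \in unzip1 s) && (mt i == Some j).
Proof.
elim: s t => //= -[a t'] s IHs t [mta _ br]; rewrite !in_cons IHs //.
rewrite [[set inr t; _]]setUC !edge_eqE xpair_eqE /=.
case: (eqVneq i a) => [->|_] //=.
rewrite mta (_ : (Some t == Some j) = (j == t)) 1?eq_sym //.
by case: (t == j); rewrite ?orbT ?andbF ?orbF.
Qed.

(** The path [P] consists of the edges of [f] and of [M] at the branch agents, [a] included, and [f]
    agrees with [M] elsewhere. Only [a] becomes newly matched. *)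
Lemma search_success a t s f :
  branch s t -> uniq (unzip1 ((a, t) :: s)) -> flips ((a, t) :: s) f ->
  edge a t \in E -> mt a = None ->
  [/\ matching bipartite (matching_of f), #|matching_of f| = #|M|.+1 &
      exists P, [/\ augmenting_path bipartite M P, P \subset E
                  & matching_of f = symdiff M P]].
Proof.
move=> br U1 flf atE mta; have f_inj := flips_injective br U1 flf.
have matchingf := matching_of_matching f_inj; move: (U1) => /= /andP[a_s Us].
have flipped i j : (i, j) \in (a, t) :: s -> mt i <> Some j.
  rewrite inE => /predU1P[[-> _]|]; first by rewrite mta.
  exact: branch_flipped br Us.
pose P := seq_edges (inl a) (inr t :: vertices s).
have bipP : P \subset bipartite.
  apply/subsetP => e; rewrite !inE => /predU1P[->|]; first exact: imset2_f.
  elim: s t {br U1 flf atE Us a_s flipped P} => //= -[a' t'] s IHs t.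
  rewrite !inE setUC => /or3P[/eqP->|/eqP->|/IHs //]; exact: imset2_f.
have memP i j : (edge i j \in P) =
    (i \in unzip1 ((a, t) :: s)) && ((f i == Some j) || (mt i == Some j)).
  rewrite !inE edges_vertices // edge_eqE orbA -xpair_eqE -in_cons.
  rewrite andb_orr; congr (_ || _).
    apply/idP/andP => [ij_s|[i_s /eqP fi]].
      have {}ij_s : (i, j) \in (a, t) :: s by [].
      by rewrite (flf.1 _ _ ij_s) eqxx; split=> //; apply: (map_f fst ij_s).
    by have [j' ij'_s] := flips_mem flf i_s; rewrite fi => -[->].
  by rewrite in_cons /=; case: (eqVneq i a) => [->|//]; rewrite mta !andbF.
split=> //.
  rewrite -(matching_of_matched_task matchingM) !card_matching_of.
  rewrite (_ : [set i | f i] = a |: [set i | [ffun i => mt i] i]).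
    by rewrite cardsU1 inE ffunE mta.
  apply/setP => i; rewrite !inE ffunE.
  have [i_s|i_s] := boolP (i \in unzip1 ((a, t) :: s)).
    have [j _ ->] := flips_mem flf i_s; move: i_s; rewrite inE.
    by case/predU1P => [->|/(branch_matched br)->]; rewrite ?eqxx ?orbT.
  by rewrite flf.2 //; move: i_s; rewrite inE negb_or => /andP[/negPf-> _].
exists P; split.
- exists (inl a), (inr jb); split=> //.
  + exists (inr t :: vertices s); split=> //.
    * by rewrite /= path_vertices andbT; apply: imset2_f.
    * have := branch_uniq_tasks br Us => U2.
      have /= -> := uniq_vertices ((a, t) :: s).
      by move: U1 U2 => /= -> ->.
    * by rewrite /= last_vertices.
  (* Edges of [P] in [M] meet [v] at most once since [M] is a matching; those outside [M] belong to
     [matching_of f], which is a matching as well. *)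
  + move=> v _; split; apply/card_le1_eqP => e e';
    rewrite [e \in _]inE [e' \in _]inE.
      move=> /and3P[_ ve eM] /and3P[_ ve' e'M].
      exact: esym (matching_sharing matchingM eM e'M ve ve').
    have in_f e0 : e0 \in P -> e0 \notin M -> e0 \in matching_of f.
      move=> e0P; have [i [j e_ij]] := bipartite_edgeP bipP e0P.
      move: e0P; rewrite e_ij memP mem_matching_of => /andP[_ /orP[//|/eqP]].
      by move/(matched_taskP matchingM) => ->.
    move=> /and3P[eP ve eM] /and3P[e'P ve' e'M].
    exact: esym (matching_sharing matchingf (in_f _ eP eM) (in_f _ e'P e'M) ve ve').
  + exact/free_agentP.
  + exact/free_taskP.
- apply/subsetP => e eP; have [i [j e_ij]] := bipartite_edgeP bipP eP.
  move: eP; rewrite {e}e_ij memP => /andP[i_s /orP[]/eqP].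
    have [j' ij'_s ->] := flips_mem flf i_s => -[<-]; move: ij'_s; rewrite inE.
    by case/predU1P => [[-> ->]//|/(branch_edge br)].
  by move/(matched_taskP matchingM)/(subsetP subME).
- apply: bipartite_eqP; first exact: matching_of_bipartite.
    have [bipM _] := matchingM.
    by rewrite subUset !(subset_trans (subsetDl _ _)).
  move=> i j; rewrite mem_matching_of !in_setU !in_setD memP.
  have -> : (edge i j \in M) = (mt i == Some j).
    by apply/(matched_taskP matchingM)/eqP.
  (* On the branch [f i] and [mt i] differ, so the edge of [M], if any, cancels and the edge of [f]
     remains; off the branch [P] has no edge. *)
  have [i_s|i_s] := boolP (i \in unzip1 ((a, t) :: s)) => /=.
    have [j' ij'_s ->] := flips_mem flf i_s.
    have := flipped _ _ ij'_s; case: (eqVneq (Some j') (Some j)) => [[->]|_] /eqP.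
      by move/negPf->.
    by case: (mt i == Some j).
  by rewrite flf.2 // andbF orbF.
Qed.

(** * Absence of augmenting paths after an exhausted search *)

Lemma search_failure F :
  candidates E F jb = set0 ->
  (forall a, a \in F -> exists2 t, mt a = Some t & candidates E F t = set0) ->
  ~ exists P, augmenting_path bipartite M P /\ P \subset E.
Proof.
move=> closed_jb closedF [P [[x [y [xyP altP neq_xy freex freey]]] PE]].
case: xyP => p [_ Uxp lastp eP].
pose reached := [set t | (t == jb) || [exists a in F, mt a == Some t]].
have reached_edge i t : t \in reached -> edge i t \in E -> i \in F.
  move=> tR itE; apply: contraT => iF.
  have : i \in candidates E F t by rewrite inE iF.
  suff -> : candidates E F t = set0 by rewrite inE.
  move: tR; rewrite inE => /predU1P[->//|/existsP[a /andP[aF /eqP mta]]].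
  by have [t' ] := closedF a aF; rewrite mta => -[->].
have edges_xp : {subset seq_edges x p <= P} by rewrite eP.
rewrite -lastp in neq_xy freey.
(* Either end of the path may come first in the sequence, so it may start at an agent or at a task;
   each case has its own trap. *)
case: x => [a|t] in freex edges_xp Uxp neq_xy lastp freey eP *.
  have aF : a \notin F.
    apply/negP => /closedF[t mta _]; move/free_agentP: freex => /(_ matchingM).
    by rewrite mta.
  (* An edge of [E] into [reached] would put its agent in [F], and a task outside [reached] is
     matched to an agent outside [F]. *)
  apply: (alternating_walk_trapped (X := inl @: ~: F) (Y := inr @: ~: reached)
    _ _ _ altP PE edges_xp Uxp neq_xy _ freex freey).
  - move=> _ v /imsetP[i iF ->] /(bipartite_inl bipartiteE)[t -> itE] _.
    apply: imset_f; rewrite inE; apply/negP => /reached_edge/(_ itE).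
    by move: iF; rewrite inE => /negP.
  - have [bipM _] := matchingM.
    move=> _ v /imsetP[t tR ->] /(bipartite_inr bipM)[i -> itM].
    apply: imset_f; rewrite inE; apply/negP => iF.
    move: tR; rewrite !inE => /norP[_ /negP].
    by apply; apply/existsP; exists i; rewrite iF; apply/eqP/matched_taskP.
  - move=> _ /imsetP[t + ->]; rewrite !inE => /norP[/saturated[i mti] _].
    by move/free_taskP => /(_ matchingM) /(_ i).
  - by apply: imset_f; rewrite inE.
have eq_tjb : t = jb.
  apply/eqP; apply: contraT => /saturated[i mti].
  by move/free_taskP: freex => /(_ matchingM) /(_ i).
(* Edges of [E] lead from [reached] into [F], and matching edges lead back. *)
apply: (alternating_walk_trapped (X := inr @: reached) (Y := inl @: F)
  _ _ _ altP PE edges_xp Uxp neq_xy _ freex freey).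
- move=> _ v /imsetP[j jR ->] /(bipartite_inr bipartiteE)[i -> ijE] _.
  exact/imset_f/(reached_edge _ j).
- have [bipM _] := matchingM.
  move=> _ v /imsetP[i iF ->] /(bipartite_inl bipM)[j -> ijM].
  apply: imset_f; rewrite inE; apply/orP; right; apply/existsP; exists i.
  by rewrite iF; apply/eqP/matched_taskP.
- move=> _ /imsetP[i /closedF[j mti _] ->] /free_agentP => /(_ matchingM).
  by rewrite mti.
- by apply: imset_f; rewrite inE eq_tjb eqxx.
Qed.

(** * The loop invariant and its preservation *)

(** The list [s] is a ghost stack, absent from the state. An explored agent off the branch has been
    backtracked, so its task has no candidate left. *)
Definition search_inv s S : Prop :=
  [/\ ~~ complete S, branch s (cur S), uniq (unzip1 s) /\ flips s (nu S),
      {subset unzip1 s <= explored S} &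
      forall a, a \in explored S -> exists2 t, mt a = Some t &
        (a \in unzip1 s) || (candidates E (explored S) t == set0)].

Definition failed S : Prop :=
  nu S = [ffun i => mt i] /\
  ~ exists P, augmenting_path bipartite M P /\ P \subset E.

Definition succeeded S : Prop :=
  [/\ matching bipartite (matching_of (nu S)), #|matching_of (nu S)| = #|M|.+1 &
      exists P, [/\ augmenting_path bipartite M P, P \subset E
                  & matching_of (nu S) = symdiff M P]].

Lemma search_inv_init : search_inv [::] (init jb M).
Proof.
split=> //=; last by move=> a; rewrite inE.
by split=> //; split=> // i _; rewrite ffunE.
Qed.

(* An exploration enlarges F and pushes one agent; a backtrack pops one. *)
Definition remaining s S := (#|~: explored S|).*2 + size s.

Lemma flips_cons a t s f : a \notin unzip1 s -> flips s f ->
  flips ((a, t) :: s) (upd f a (Some t)).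
Proof.
move=> a_s [f_s f_out]; split=> i => [j|].
  rewrite inE => /predU1P[[-> ->]|ij_s]; first exact: upd_same.
  rewrite upd_other; first exact: f_s.
  by apply: contraNneq a_s => <-; apply: (map_f fst ij_s).
by rewrite inE negb_or => /andP[ia /f_out <-]; apply: upd_other.
Qed.

Lemma candidatesS F F' t : F \subset F' ->
  candidates E F t = set0 -> candidates E F' t = set0.
Proof.
move=> /subsetP FF' candF; apply/setP => i; rewrite !inE.
have /setP/(_ i) := candF; rewrite !inE; apply: contraFF => /andP[iF' ->].
by rewrite andbT; apply: contra iF' => /FF'.
Qed.

(** A step either finishes with a known outcome or keeps the invariant with a smaller measure; this
    serves both correctness and termination. *)
Lemma search_inv_step s S S' : search_inv s S -> step jb M E S S' ->
  complete S' /\ (failed S' \/ succeeded S') \/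
  exists s', search_inv s' S' /\ remaining s' S' < remaining s S.
Proof.
move=> [nc br [Us fls] sF expl] st; case: st nc br fls sF expl => /=.
- move=> F f t candt eq_t _; rewrite {t}eq_t in candt * => br fls sF expl.
  left; split=> //; left.
  (* The head of a nonempty branch would be matched to [jb]; hence the branch is empty and every
     explored agent is exhausted. *)
  case: s br Us fls sF expl => [|[a t] s]; last by case=> /jb_unmatched.
  move=> _ _ fls _ expl; split.
    by apply/ffunP => i; rewrite ffunE fls.2.
  apply: (search_failure candt) => a /expl[t mta /eqP]; by exists t.
- move=> F f t a t' candt neq_t mta fa _; case: s Us => [|[a' t1] s].
    by move=> _ /= eq_t; rewrite eq_t eqxx in neq_t.
  move=> /= /andP[a_s Us] [mta' _ br] fls sF expl; right; exists s.
  (* Only one agent is matched to [t], so the agent backtracked from is the head of the branch, and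
     its [nu] is the task it was explored from. *)
  have eq_a := matched_task_inj matchingM mta' mta; subst a'.
  have eq_t1 : t1 = t'.
    by apply: Some_inj; rewrite -fa (fls.1 a t1) // mem_head.
  subst t1; split; last by rewrite /remaining /= addnS.
  split=> //=.
  + split=> //; split=> i => [j ij_s|i_s].
      rewrite upd_other; first by apply: (fls.1 i j); rewrite inE ij_s orbT.
      by apply: contraNneq a_s => <-; apply: (map_f fst ij_s).
    have [->|neq_ia] := eqVneq i a; first exact: upd_same.
    by rewrite upd_other // fls.2 // inE negb_or neq_ia.
  + by move=> i i_s; apply: sF; rewrite inE i_s orbT.
  (* The popped agent leaves the branch, but its task [t] has just run out of candidates. *)
  + move=> i /expl[j mti i_s]; exists j => //; move: i_s; rewrite inE -orbA.
    case/predU1P => [eq_i|//]; move: mti; rewrite eq_i mta => -[<-].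
    by rewrite candt eqxx orbT.
- move=> F f t a; rewrite inE => /andP[aF atE] mta _ br fls sF expl.
  have a_s : a \notin unzip1 s by apply: contra aF => /sF.
  left; split=> //; right; apply: (search_success br _ _ atE mta).
    by rewrite /= a_s.
  exact: flips_cons.
- move=> F f t a t'; rewrite inE => /andP[aF atE] mta _ br fls sF expl.
  have a_s : a \notin unzip1 s by apply: contra aF => /sF.
  right; exists ((a, t) :: s); split.
    split=> //=; first by split; [rewrite a_s | apply: flips_cons].
      move=> i; rewrite !inE => /predU1P[->|/sF->]; rewrite ?eqxx ?orbT //.
    move=> i; rewrite in_setU1 => /predU1P[->|/expl[j mti /orP i_s]].
      by exists t'; rewrite ?mem_head.
    exists j => //; rewrite in_cons; case: i_s => [->|/eqP candj].
      by rewrite orbT.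
    by rewrite (candidatesS _ candj) ?subsetUr // eqxx orbT.
  (* One agent leaves the complement of [F], which counts twice, against one pushed pair. *)
  rewrite /remaining /= (cardsD1 a (~: F)) inE aF setCU setIC -setDE.
  by rewrite doubleS !addSn addnS ltnS.
Qed.

(** * Termination and the returned matchings *)

Lemma search_no_infinite_run s (r : nat -> state A B) :
  search_inv s (r 0) -> ~ forall k, step jb M E (r k) (r k.+1).
Proof.
have [n] := ubnP (remaining s (r 0)).
elim: n s r => // n IHn s r rem_n inv_s run.
case: (search_inv_step inv_s (run 0)) => [[compl1 _]|[s' [inv_s' rem_s']]].
  by case: (run 1) compl1.
apply: (IHn s' (fun k => r k.+1)) => //.
exact: leq_trans rem_s' _.
Qed.

Lemma search_progress s S : search_inv s S -> exists S', step jb M E S S'.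
Proof.
case: S => F f t [|] [//= _ br [_ fls] _ _].
have [cand0|[a a_cand]] := set_0Vmem (candidates E F t); last first.
  case mta: (mt a) => [t'|].
    by eexists; apply: step_explore a_cand mta.
  by eexists; apply: step_found a_cand mta.
have [eq_t|neq_t] := eqVneq t jb; first by eexists; apply: step_fail.
(* The head of the branch supplies both the agent matched to [t] and its stored task, so
   backtracking is possible. *)
case: s br fls => [/= eq_t|[a t'] s]; first by rewrite eq_t eqxx in neq_t.
move=> [mta _ _] fls; eexists; apply: step_back mta (_ : _ = Some t') => //.
by apply: (fls.1 a t'); rewrite mem_head.
Qed.

Lemma reachable_search_inv S : reachable jb M E S ->
  (exists s, search_inv s S) \/ complete S /\ (failed S \/ succeeded S).
Proof.
elim=> [|S1 S2 _ IH st]; first by left; exists [::]; apply: search_inv_init.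
(* A complete state has no successor, so the step starts from a running state. *)
case: IH => [[s inv_s]|[compl _]]; last by case: st compl.
case: (search_inv_step inv_s st) => [|[s' [inv_s' _]]]; first by right.
by left; exists s'.
Qed.

Lemma search_terminates : augdfs_terminates jb M E.
Proof.
split=> [[r [r0]]|S].
  by apply: (search_no_infinite_run (s := [::])); rewrite r0; apply: search_inv_init.
by case/reachable_search_inv => [[s /search_progress]|[->]].
Qed.

Lemma search_returns Mnu : augdfs_returns jb M E Mnu ->
  Mnu = M /\ (~ exists P, augmenting_path bipartite M P /\ P \subset E) \/
  [/\ matching bipartite Mnu, #|Mnu| = #|M|.+1 &
      exists P, [/\ augmenting_path bipartite M P, P \subset E
                  & Mnu = symdiff M P]].
Proof.
case=> S [+ compl ->] => /reachable_search_inv[[s []]|[_ [[-> noP]|]]].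
- by rewrite compl.
- by left; rewrite matching_of_matched_task.
- by right.
Qed.

End Search.

(** * Removal of an edge from a maximum matching *)

Theorem lemma2 (A B : finType) (m n : nat)
    (cardA : #|A| = m) (cardB : #|B| = n) (le_nm : n <= m) (n_ge1 : 1 <= n)
    (R : realFieldType) (w : A -> B -> R)
    (comm : rel A) (comm_undirected : symmetric comm)
    (comm_connected : forall i i' : A, connect comm i i')
    (E' M : {set {set A + B}})
    (E'_sub : E' \subset complete_bipartite A B)
    (M_sub : M \subset E')
    (M_mcm : max_card_matching (complete_bipartite A B) M)
    (ib : A) (jb : B) (eb_in : edge ib jb \in M) :
  let Gb := complete_bipartite A B in
  let Mbar := M :\ edge ib jb in
  let Ebar := E' :\ edge ib jb in
  let has_augmenting_path :=
    exists P, augmenting_path Gb Mbar P /\ P \subset Ebar in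
  augdfs_terminates jb Mbar Ebar /\
  forall Mnu, augdfs_returns jb Mbar Ebar Mnu ->
    [/\ has_augmenting_path <-> Mnu <> Mbar,
        has_augmenting_path ->
          max_card_matching Gb Mnu /\
          exists P, [/\ augmenting_path Gb Mbar P, P \subset Ebar
                      & Mnu = symdiff Mbar P]
      & ~ has_augmenting_path -> Mnu = Mbar].
Proof.
move=> Gb Mbar Ebar has_augmenting_path.
have [matchingM maxM] := M_mcm; have [bipM trivM] := matchingM.
have matchingMbar : matching Gb Mbar.
  split; first exact: subset_trans (subsetDl _ _) bipM.
  exact: trivIsetS (subsetDl _ _) trivM.
have saturatedM t : exists i, edge i t \in M.
  by apply: max_matching_saturates M_mcm t; rewrite cardA cardB.
(* Only [ib] is matched to [jb] in [M], and that edge has been removed; every other task keeps its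
   agent. *)
have jb_unmatched i : matched_task Mbar i <> Some jb.
  move/(matched_taskP matchingMbar); rewrite !inE => /andP[/negP neq_e ijM].
  apply: neq_e; rewrite (_ : i = ib) //.
  by apply: (matched_task_inj matchingM (j := jb)); apply/matched_taskP.
have saturated t : t != jb -> exists i, matched_task Mbar i = Some t.
  move=> neq_t; have [i itM] := saturatedM t; exists i.
  by apply/matched_taskP; rewrite // in_setD1 edge_eqE (negPf neq_t) andbF.
have bipEbar : Ebar \subset Gb := subset_trans (subsetDl _ _) E'_sub.
have subMEbar : Mbar \subset Ebar := setSD _ M_sub.
split=> [|Mnu]; first exact: search_terminates.
case/search_returns => // [[-> noP]|[matchingMnu cardMnu existsP]].
  by split=> // [|/noP//]; split=> [/noP|].
have has_path : has_augmenting_path.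
  by have [P [augP PE _]] := existsP; exists P.
split=> [|_|/(_ has_path)//].
  split=> // _ eqM; have /eqP := cardMnu.
  by rewrite eqM -addn1 -[X in X == _]addn0 eqn_add2l.
(* The flip regains the removed edge in number: [#|Mnu| = #|Mbar| + 1 = #|M|], the maximum. *)
split=> //; split=> // M' /maxM.
by rewrite cardMnu (cardsD1 (edge ib jb) M) eb_in add1n.
Qed.
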